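(* Let $p\ge 1$ be an integer and let $F$ be a polyharmonic mapping in the unit disk $\mathbb{D}$ of the form $$F(z)=\sum_{n=1}^{p}|z|^{2(n-1)}\big(h_n(z)+\overline{g_n(z)}\big)=\sum_{n=1}^{p}|z|^{2(n-1)}\sum_{j=1}^{\infty}\big(a_{n,j}z^{j}+\overline{b_{n,j}}\,\overline{z}^{j}\big).$$ Suppose that for all $j\ge 1$ and $n_1,n_2\in\{1,\dots,p\}$, $$\left|\arg\left\{\frac{a_{n_1,j}}{a_{n_2,j}}\right\}\right|\le\frac{\pi}{2}\quad\text{whenever } a_{n_1,j},a_{n_2,j}\neq 0,\qquad \left|\arg\left\{\frac{b_{n_1,j}}{b_{n_2,j}}\right\}\right|\le\frac{\pi}{2}\quad\text{whenever } b_{n_1,j},b_{n_2,j}\ne 0.$$ Then for all $j\geq 1$, $$\sum_{n=1}^{p}|a_{n,j}|\le \frac{\sqrt p}{2}\operatorname{Diam}F(\mathbb{D}),\qquad \sum_{n=1}^{p}|b_{n,j}|\le \frac{\sqrt p}{2}\operatorname{Diam}F(\mathbb{D}),$$ and $$\sum_{n=1}^{p}\big(|a_{n,j}|+|b_{n,j}|\big)\le\frac{\sqrt{2p}}{2}\operatorname{Diam}F(\mathbb{D}).$$ Moreover, for $p=1$ the first inequality is sharp (equality is attained) for the mappings $F(z)=Cz^{m}$, and the second inequality is sharp for the mappings $F(z)=C\overline{z}^{m}$, where $C$ is a constant and $m\ge1$ is an integer.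
   Context: $\mathbb{D}=\{z\in\mathbb{C}:|z|<1\}$. A complex-valued mapping $F$ is polyharmonic ($p$-harmonic) in a domain if $\Delta^pF=0$ there, where $\Delta=4\,\partial^2/\partial z\partial\overline z$. In the displayed form, $h_n(z)=\sum_{j\ge1}a_{n,j}z^j$ and $g_n(z)=\sum_{j\ge1}b_{n,j}z^j$ are analytic in $\mathbb{D}$ with complex coefficients. $\operatorname{Diam}F(\mathbb{D})=\sup_{z,w\in\mathbb{D}}|F(z)-F(w)|$. $\arg$ denotes the principal argument in $(-\pi,\pi]$. *)

(* Defs.v *)
(* Stdlib real numbers with Coquelicot. *)
From Stdlib Require Import Reals Lra Lia.
From Coquelicot Require Import Coquelicot.
Open Scope R_scope.

Definition unit_disk (z : C) : Prop := Cmod z < 1.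

(* A value in [0, +oo]: the diameter is [p_infty] when [F] is unbounded. *)
Definition Diam_image_disk (F : C -> C) : Rbar :=
  Lub_Rbar (fun r => exists z w : C,
    unit_disk z /\ unit_disk w /\ r = Cmod (F z - F w)%C).

(* Principal argument, with values in (-PI, PI]; the value at 0 is junk. *)
Definition Carg (z : C) : R :=
  if Rle_dec 0 (Im z) then acos (Re z / Cmod z) else - acos (Re z / Cmod z).

Lemma Carg_spec (z : C) : z <> 0%C ->
  - PI < Carg z <= PI /\
  z = (Cmod z * cos (Carg z), Cmod z * sin (Carg z)).
Proof.
destruct z as [x y]; intros hz.
assert (hm : 0 < Cmod (x, y)) by now apply Cmod_gt_0.
assert (hsq : Cmod (x, y) * Cmod (x, y) = x * x + y * y).
{ unfold Cmod; simpl fst; simpl snd; rewrite sqrt_sqrt; nra. }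
unfold Carg; simpl Re; simpl Im.
set (m := Cmod (x, y)) in *; set (q := x / m).
assert (hx : x = m * q) by (unfold q; field; lra).
assert (hy : y * y = (m * m) * (1 - q * q)) by (rewrite hx in hsq; nra).
assert (hq : -1 <= q <= 1).
{ assert (hm2 : 0 < m * m) by nra.
  assert (q * q <= 1).
  { destruct (Rle_dec (q * q) 1) as [h|h]; [exact h|nra]. }
  nra. }
assert (hs : m * sqrt (1 - Rsqr q) = Rabs y).
{ rewrite <- (sqrt_Rsqr_abs y); unfold Rsqr; rewrite hy.
  rewrite sqrt_mult by nra; rewrite sqrt_square by lra; reflexivity. }
pose proof (acos_bound q) as hb; pose proof PI_RGT_0 as hpi.
destruct (Rle_dec 0 y) as [h|h].
- split; [lra|].
  rewrite cos_acos, sin_acos by exact hq.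
  rewrite hs, Rabs_pos_eq by exact h; now rewrite <- hx.
- split.
  + assert (acos q <> PI); [|lra].
    intros e; pose proof (cos_acos q hq) as hc; rewrite e, cos_PI in hc.
    rewrite <- hc in hy; nra.
  + rewrite cos_neg, sin_neg, cos_acos, sin_acos by exact hq.
    replace (m * - sqrt (1 - Rsqr q)) with (- (m * sqrt (1 - Rsqr q))) by ring.
    rewrite hs, Rabs_left by lra; rewrite <- hx, Ropp_involutive; reflexivity.
Qed.

Definition partial_x (F : C -> C) (z : C) : C :=
  (Derive (fun t => Re (F (t, Im z))) (Re z),
   Derive (fun t => Im (F (t, Im z))) (Re z)).

Definition partial_y (F : C -> C) (z : C) : C :=
  (Derive (fun t => Re (F (Re z, t))) (Im z),
   Derive (fun t => Im (F (Re z, t))) (Im z)).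

Definition wirtinger_z (F : C -> C) (z : C) : C :=
  ((partial_x F z - Ci * partial_y F z) / 2)%C.

Definition wirtinger_zbar (F : C -> C) (z : C) : C :=
  ((partial_x F z + Ci * partial_y F z) / 2)%C.

Definition Laplacian (F : C -> C) (z : C) : C :=
  (4 * wirtinger_z (wirtinger_zbar F) z)%C.

(* [F] is of class C^k on the disk in the real sense. This is needed because
   [Derive] is a total operator. *)
Fixpoint smooth_disk (k : nat) (F : C -> C) : Prop :=
  match k with
  | O => forall z : C, unit_disk z ->
           continuous (U := C_UniformSpace) F z
  | S k' =>
      (forall z : C, unit_disk z ->
         ex_derive (V := C_R_NormedModule) (fun t : R => F (t, Im z)) (Re z) /\
         ex_derive (V := C_R_NormedModule) (fun t : R => F (Re z, t)) (Im z)) /\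
      smooth_disk k' (partial_x F) /\ smooth_disk k' (partial_y F)
  end.

Definition polyharmonic_disk (p : nat) (F : C -> C) : Prop :=
  smooth_disk (2 * p) F /\
  forall z : C, unit_disk z -> Nat.iter p Laplacian F z = 0%C.

(* [h] is analytic in the disk, with Taylor series sum_(j >= 1) c_j z^j; the
   value [c 0] is not used. *)
Definition disk_power_series (c : nat -> C) (h : C -> C) : Prop :=
  forall z : C, unit_disk z ->
    is_series (K := C_AbsRing) (V := C_NormedModule)
      (fun k => (c (S k) * z ^ S k)%C) (h z).

Definition polyharmonic_form (p : nat) (a b : nat -> nat -> C) (F : C -> C) :
  Prop :=
  exists h g : nat -> C -> C,
    (forall n, (1 <= n <= p)%nat ->
       disk_power_series (a n) (h n) /\ disk_power_series (b n) (g n)) /\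
    forall z : C, unit_disk z ->
      F z = sum_n_m (G := C_AbelianMonoid)
              (fun n => (RtoC (Cmod z ^ (2 * (n - 1))) *
                         (h n z + Cconj (g n z)))%C) 1 p.

Definition arg_condition (p : nat) (c : nat -> nat -> C) : Prop :=
  forall j n1 n2 : nat,
    (1 <= j)%nat -> (1 <= n1 <= p)%nat -> (1 <= n2 <= p)%nat ->
    c n1 j <> 0%C -> c n2 j <> 0%C ->
    Rabs (Carg (c n1 j / c n2 j)%C) <= PI / 2.

(* The coefficient array whose only nonzero entry is [C0] at index [(1, m)]. *)
Definition monomial_coeff (C0 : C) (m n j : nat) : C :=
  if (Nat.eqb n 1 && Nat.eqb j m)%bool then C0 else 0%C.

Definition zero_coeff (n j : nat) : C := 0%C.

(* Main.v *)
Require Import Defs.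
From Stdlib Require Import ZArith Reals Lra Lia FunctionalExtensionality.
From Coquelicot Require Import Coquelicot.
Open Scope R_scope.

(** On the circle of radius [r], the map [F] is a Fourier series in which the
    frequency [j] has coefficient [A = sum_n r ^ (2 (n - 1) + j) a_(n,j)] and the
    frequency [- j] has coefficient
    [B = sum_n r ^ (2 (n - 1) + j) conj b_(n,j)].
    Rotating [z] by the angle [PI / j] changes the sign of both, so
    [z |-> F z - F (z e ^ (i PI / j))], which is bounded by the diameter [K],
    has coefficients [2 A] and [2 B] there. Bessel's inequality for these two
    frequencies gives [4 (|A| ^ 2 + |B| ^ 2) <= K ^ 2] ([mode_pair_le]).

    The condition on the arguments says that the numbers [a_(n,j)], for fixed
    [j], pairwise make angles of at most [PI / 2], so that cancellation in [A]
    is limited: [|A| ^ 2] is at least the sum of the squared moduli of its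
    terms, hence, by the Cauchy-Schwarz inequality, at least [1 / p] times the
    square of the sum of these moduli ([sum_Cmod_sq_le]); likewise for [B].
    Letting [r] tend to 1 yields
    [4 ((sum |a_(n,j)|) ^ 2 + (sum |b_(n,j)|) ^ 2) <= p K ^ 2]
    ([coefficient_sq_le]), which contains the three estimates.

    Fourier coefficients are taken as limits of averages over roots of unity
    rather than as integrals: such averages are linear in the function without
    any integrability condition, and the orthogonality of the characters is
    the sum of a geometric progression ([mean_cis]).

    For a monomial with coefficient [C0] the modulus is at most [|C0|] on the
    disk, so that the diameter is at most [2 |C0|], while the first (or second)
    estimate says that it is at least that: the bound is attained. *)

(** The generic finite sum at type [C], on which [ring] and [rewrite] act
    without having to see through the algebraic structures. *)
Definition csum (u : nat -> C) (n : nat) : C := sum_n (G := C_AbelianMonoid) u n.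

Lemma csum_O (u : nat -> C) : csum u 0 = u 0%nat.
Proof. exact (sum_O u). Qed.

Lemma csum_ext (u v : nat -> C) (n : nat) :
  (forall k, u k = v k) -> csum u n = csum v n.
Proof. exact (sum_n_ext (G := C_AbelianMonoid) u v n). Qed.

Lemma csum_S (u : nat -> C) (n : nat) : csum u (S n) = (csum u n + u (S n))%C.
Proof. exact (sum_Sn u n). Qed.

Lemma csum_scal (c : C) (u : nat -> C) (n : nat) :
  csum (fun k => (c * u k)%C) n = (c * csum u n)%C.
Proof. exact (sum_n_mult_l (K := C_Ring) c u n). Qed.

Lemma csum_plus (u v : nat -> C) (n : nat) :
  csum (fun k => (u k + v k)%C) n = (csum u n + csum v n)%C.
Proof. exact (sum_n_plus (G := C_AbelianMonoid) u v n). Qed.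

Lemma csum_conj (u : nat -> C) (n : nat) :
  csum (fun k => Cconj (u k)) n = Cconj (csum u n).
Proof.
induction n as [|n IH]; [now rewrite !csum_O|].
now rewrite !csum_S, IH, Cplus_conj.
Qed.

Lemma csum_single (u : nat -> C) (j n : nat) :
  (forall k, k <> j -> u k = 0%C) -> (j <= n)%nat -> csum u n = u j.
Proof.
intros hu; induction n as [|n IH]; intros hj.
- replace j with 0%nat by lia; apply csum_O.
- rewrite csum_S; destruct (Nat.eq_dec j (S n)) as [->|hne].
  + assert (h0 : forall m, (m <= n)%nat -> csum u m = 0%C).
    { induction m as [|m IHm]; intros hm.
      - rewrite csum_O; apply hu; lia.
      - rewrite csum_S, IHm, hu by lia; ring. }
    rewrite h0 by lia; ring.
  + rewrite IH, (hu (S n)) by lia; ring.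
Qed.

Lemma Cconj_RtoC (x : R) : Cconj (RtoC x) = RtoC x.
Proof. unfold Cconj, RtoC; simpl; f_equal; ring. Qed.

(** * The unit circle and averages over roots of unity *)

Definition cis (t : R) : C := (cos t, sin t).

Lemma cis_plus (s t : R) : cis (s + t) = (cis s * cis t)%C.
Proof.
unfold cis, Cmult; simpl; rewrite cos_plus, sin_plus; f_equal; ring.
Qed.

Lemma cis_0 : cis 0 = 1%C.
Proof. unfold cis; now rewrite cos_0, sin_0. Qed.

Lemma Cconj_cis (t : R) : Cconj (cis t) = cis (- t).
Proof. unfold cis, Cconj; simpl; now rewrite cos_neg, sin_neg. Qed.

Lemma Cmod_cis (t : R) : Cmod (cis t) = 1.
Proof.
unfold Cmod, cis; simpl.
replace (_ + _) with 1; [apply sqrt_1|].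
pose proof (sin2_cos2 t); unfold Rsqr in *; lra.
Qed.

Lemma cis_pow (t : R) (k : nat) : (cis t ^ k)%C = cis (INR k * t).
Proof.
induction k as [|k IH].
- now rewrite Rmult_0_l, cis_0.
- rewrite Cpow_S, IH, <- cis_plus, S_INR; f_equal; ring.
Qed.

(** The denominator is [N + 1], so that there is always at least one sample
    point. *)
Definition node (N k : nat) : R := 2 * PI * INR k / INR (S N).

Definition mean (N : nat) (f : R -> C) : C :=
  (csum (fun k => f (node N k)) N / RtoC (INR (S N)))%C.

Lemma INR_S_neq0 (N : nat) : RtoC (INR (S N)) <> 0%C.
Proof. intros h; apply RtoC_inj in h; now apply (not_0_INR (S N)). Qed.

Lemma mean_ext (N : nat) (f g : R -> C) :
  (forall t, f t = g t) -> mean N f = mean N g.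
Proof. intros h; unfold mean; f_equal; now apply csum_ext. Qed.

Lemma mean_plus (N : nat) (f g : R -> C) :
  mean N (fun t => f t + g t)%C = (mean N f + mean N g)%C.
Proof. unfold mean, Cdiv; rewrite csum_plus; ring. Qed.

Lemma mean_scal (N : nat) (c : C) (f : R -> C) :
  mean N (fun t => c * f t)%C = (c * mean N f)%C.
Proof. unfold mean, Cdiv; rewrite csum_scal; ring. Qed.

Lemma mean_conj (N : nat) (f : R -> C) :
  mean N (fun t => Cconj (f t)) = Cconj (mean N f).
Proof.
unfold mean; rewrite csum_conj, Cdiv_conj by apply INR_S_neq0.
now rewrite Cconj_RtoC.
Qed.

Lemma mean_csum (N M : nat) (u : nat -> R -> C) :
  mean N (fun t => csum (fun k => u k t) M) = csum (fun k => mean N (u k)) M.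
Proof.
induction M as [|M IH].
- rewrite csum_O; apply mean_ext; intros t; now rewrite csum_O.
- rewrite csum_S, <- IH, <- mean_plus; apply mean_ext; intros t.
  now rewrite csum_S.
Qed.

Lemma mean_const (N : nat) (c : C) : mean N (fun _ => c) = c.
Proof.
unfold mean.
assert (h : forall n, csum (fun _ => c) n = (RtoC (INR (S n)) * c)%C).
{ induction n as [|n IH].
  - rewrite csum_O; simpl; ring.
  - rewrite csum_S, IH, (S_INR (S n)), RtoC_plus; ring. }
rewrite h; field; apply INR_S_neq0.
Qed.

Lemma Cmod_mean_le (N : nat) (f : R -> C) (K : R) :
  (forall t, Cmod (f t) <= K) -> Cmod (mean N f) <= K.
Proof.
intros hf; unfold mean.
rewrite Cmod_div by apply INR_S_neq0.
rewrite Cmod_R, Rabs_pos_eq by apply pos_INR.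
assert (hN : 0 < INR (S N)) by (apply lt_0_INR; lia).
apply Rle_div_l; [exact hN|].
assert (h : forall n u, (forall k, Cmod (u k) <= K) ->
  Cmod (csum u n) <= K * INR (S n)).
{ intros n u hu; induction n as [|n IH].
  - rewrite csum_O; simpl; rewrite Rmult_1_r; apply hu.
  - rewrite csum_S, (S_INR (S n)).
    pose proof (Cmod_triangle (csum u n) (u (S n))); specialize (hu (S n)); lra. }
now apply h.
Qed.

Lemma Re_mean_ge0 (N : nat) (f : R -> C) :
  (forall t, 0 <= Re (f t)) -> 0 <= Re (mean N f).
Proof.
intros hf; unfold mean, Cdiv.
rewrite <- RtoC_inv, Cmult_comm, re_scal_l by now apply (not_0_INR (S N)).
apply Rmult_le_pos.
- left; apply Rinv_0_lt_compat, lt_0_INR; lia.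
- assert (h : forall n u, (forall k, 0 <= Re (u k)) -> 0 <= Re (csum u n)).
  { intros n u hu; induction n as [|n IH].
    - rewrite csum_O; apply hu.
    - rewrite csum_S, re_plus; specialize (hu (S n)); lra. }
  now apply h.
Qed.

Lemma cis_neq1 (t : R) : 0 < Rabs t < 2 * PI -> cis t <> 1%C.
Proof.
intros ht h; apply (f_equal fst) in h; cbn in h.
assert (hs : sin (t / 2) <> 0).
{ unfold Rabs in ht; destruct (Rcase_abs t).
  - pose proof (sin_gt_0 (- (t / 2))); rewrite sin_neg in *; lra.
  - pose proof (sin_gt_0 (t / 2)); lra. }
replace t with (2 * (t / 2)) in h by field.
rewrite cos_2a_sin in h; apply hs; nra.
Qed.

Lemma geometric_csum (q : C) (n : nat) :
  ((1 - q) * csum (fun k => q ^ k)%C n)%C = (1 - q ^ S n)%C.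
Proof.
induction n as [|n IH].
- rewrite csum_O; simpl; ring.
- rewrite csum_S, Cmult_plus_distr_l, IH, !Cpow_S; ring.
Qed.

Lemma cis_2PI_IZR (m : Z) : cis (2 * PI * IZR m) = 1%C.
Proof.
assert (hn : forall n, cis (2 * PI * INR n) = 1%C).
{ intros n; rewrite Rmult_comm, <- cis_pow; unfold cis.
  rewrite cos_2PI, sin_2PI; apply Cpow_1_l. }
destruct (Z.le_gt_cases 0 m).
- rewrite <- (Z2Nat.id m), <- INR_IZR_INZ by lia; apply hn.
- replace m with (- Z.of_nat (Z.to_nat (- m)))%Z by lia.
  rewrite opp_IZR, <- INR_IZR_INZ, Ropp_mult_distr_r_reverse, <- Cconj_cis, hn.
  apply Cconj_RtoC.
Qed.

(** Orthogonality of characters: for nonzero frequencies smaller than the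
    number of sample points the samples form a full geometric progression of ratio
    different from 1, whose sum vanishes. *)
Lemma mean_cis (N : nat) (m : Z) : (Z.abs m <= Z.of_nat N)%Z ->
  mean N (fun t => cis (IZR m * t)) = if Z.eq_dec m 0 then 1%C else 0%C.
Proof.
intros hm; destruct (Z.eq_dec m 0) as [->|hne].
- rewrite <- (mean_const N 1); apply mean_ext; intros t.
  now rewrite Rmult_0_l, cis_0.
- set (q := cis (2 * PI * IZR m / INR (S N))).
  assert (hN : 0 < INR (S N)) by (apply lt_0_INR; lia).
  pose proof PI_RGT_0 as hpi.
  assert (hq : q <> 1%C).
  { apply cis_neq1.
    unfold Rdiv; rewrite !Rabs_mult, Rabs_inv, <- (abs_IZR m).
    rewrite (Rabs_pos_eq 2), (Rabs_pos_eq PI), (Rabs_pos_eq (INR _)) by lra.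
    assert (h1 : 0 < IZR (Z.abs m)) by (apply IZR_lt; lia).
    assert (h2 : IZR (Z.abs m) < INR (S N))
      by (rewrite INR_IZR_INZ; apply IZR_lt; lia).
    assert (h3 : 0 < IZR (Z.abs m) * / INR (S N) < 1).
    { split; [apply Rmult_lt_0_compat; [lra|now apply Rinv_0_lt_compat]|].
      apply Rlt_div_l; lra. }
    nra. }
  assert (hg := geometric_csum q N).
  assert (hqN : (q ^ S N)%C = 1%C).
  { unfold q; rewrite cis_pow, <- (cis_2PI_IZR m); f_equal; field; lra. }
  rewrite hqN in hg.
  assert (h0 : csum (fun k => q ^ k)%C N = 0%C).
  { assert (h1q : (1 - q)%C <> 0%C).
    { intros h; apply hq; replace q with (1 - (1 - q))%C by ring.
      rewrite h; ring. }
    replace (csum (fun k => q ^ k)%C N)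
      with (/ (1 - q) * ((1 - q) * csum (fun k => q ^ k)%C N))%C by (field; exact h1q).
    rewrite hg; ring. }
  unfold mean.
  rewrite (csum_ext _ (fun k => q ^ k)%C).
  + rewrite h0; unfold Cdiv; ring.
  + intros k; unfold q, node; rewrite cis_pow; f_equal; field; lra.
Qed.

(** * Fourier coefficients as limits of discrete averages *)

Definition fourier_coeff (f : R -> C) (m : Z) (c : C) : Prop :=
  is_lim_seq (fun N => Cmod (mean N (fun t => f t * cis (- (IZR m * t)))%C - c)) 0.

Lemma fourier_coeff_ext (f g : R -> C) (m : Z) (c : C) :
  (forall t, f t = g t) -> fourier_coeff f m c -> fourier_coeff g m c.
Proof.
intros h; apply is_lim_seq_ext; intros N; do 2 f_equal.
apply mean_ext; intros t; now rewrite h.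
Qed.

Lemma fourier_coeff_plus (f g : R -> C) (m : Z) (c d : C) :
  fourier_coeff f m c -> fourier_coeff g m d ->
  fourier_coeff (fun t => f t + g t)%C m (c + d)%C.
Proof.
intros hf hg; unfold fourier_coeff.
pose proof (is_lim_seq_plus' _ _ _ _ hf hg) as h; rewrite Rplus_0_l in h.
eapply is_lim_seq_le_le; [|apply is_lim_seq_const|exact h].
intros N; split; [apply Cmod_ge_0|].
eapply Rle_trans; [|apply Cmod_triangle]; right; f_equal.
rewrite (mean_ext N (fun t => (f t + g t) * cis (- (IZR m * t)))%C
  (fun t => f t * cis (- (IZR m * t)) + g t * cis (- (IZR m * t)))%C)
  by (intros t; ring).
rewrite mean_plus; ring.
Qed.

Lemma fourier_coeff_scal (a : C) (f : R -> C) (m : Z) (c : C) :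
  fourier_coeff f m c -> fourier_coeff (fun t => a * f t)%C m (a * c)%C.
Proof.
intros hf; unfold fourier_coeff.
replace 0 with (Cmod a * 0) by ring.
eapply is_lim_seq_ext; [|exact (is_lim_seq_scal_l _ (Cmod a) _ hf)].
intros N; simpl; rewrite <- Cmod_mult; f_equal.
rewrite (mean_ext N (fun t => a * f t * cis (- (IZR m * t)))%C
  (fun t => a * (f t * cis (- (IZR m * t))))%C) by (intros t; ring).
rewrite mean_scal; ring.
Qed.

Lemma fourier_coeff_conj (f : R -> C) (m : Z) (c : C) :
  fourier_coeff f m c -> fourier_coeff (fun t => Cconj (f t)) (- m) (Cconj c).
Proof.
apply is_lim_seq_ext; intros N.
rewrite <- Cmod_conj, Cminus_conj, <- mean_conj; do 2 f_equal.
apply mean_ext; intros t.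
rewrite Cmult_conj, Cconj_cis; do 2 f_equal; rewrite opp_IZR; ring.
Qed.

Lemma fourier_coeff_zero (m : Z) : fourier_coeff (fun _ => 0%C) m 0%C.
Proof.
apply (is_lim_seq_ext (fun _ => 0)); [|apply is_lim_seq_const]; intros N.
rewrite (mean_ext N _ (fun _ => 0%C)) by (intros t; ring).
rewrite mean_const; replace (0 - 0)%C with (RtoC 0) by ring; now rewrite Cmod_0.
Qed.

Lemma fourier_coeff_sum (f : nat -> R -> C) (m : Z) (c : nat -> C) (p : nat) :
  (forall n, (1 <= n <= p)%nat -> fourier_coeff (f n) m (c n)) ->
  fourier_coeff (fun t => sum_n_m (G := C_AbelianMonoid) (fun n => f n t) 1 p) m
    (sum_n_m (G := C_AbelianMonoid) c 1 p).
Proof.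
induction p as [|p IH]; intros h.
- rewrite sum_n_m_zero by lia.
  eapply fourier_coeff_ext; [|apply fourier_coeff_zero].
  intros t; now rewrite sum_n_m_zero by lia.
- rewrite sum_n_Sm by lia.
  eapply fourier_coeff_ext; [|apply fourier_coeff_plus;
    [apply IH; intros; apply h; lia|apply h; lia]].
  intros t; cbv beta; now rewrite (sum_n_Sm (fun n => f n t)) by lia.
Qed.

Lemma Cmod_csum_sub_le (u : nat -> C) (M n : nat) : (M <= n)%nat ->
  Cmod (csum u n - csum u M) <=
  sum_n (fun k => Cmod (u k)) n - sum_n (fun k => Cmod (u k)) M.
Proof.
induction 1 as [|n h IH].
- replace (csum u M - csum u M)%C with (RtoC 0) by ring; rewrite Cmod_0; lra.
- rewrite csum_S, sum_Sn.
  replace (csum u n + u (S n) - csum u M)%C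
    with ((csum u n - csum u M) + u (S n))%C by ring.
  pose proof (Cmod_triangle (csum u n - csum u M) (u (S n))).
  unfold plus in *; simpl in *; lra.
Qed.

Lemma is_lim_seq_csum (u : nat -> C) (l : C) :
  is_series (K := C_AbsRing) (V := C_NormedModule) u l ->
  is_lim_seq (fun n => Cmod (l - csum u n)) 0.
Proof.
intros h; apply is_lim_seq_spec; intros eps.
generalize (proj1 (filterlim_locally_ball_norm
  (K := C_AbsRing) (U := C_NormedModule) _ _) h eps); apply filter_imp; intros n hn.
rewrite Rminus_0_r, Rabs_pos_eq by apply Cmod_ge_0.
rewrite <- Cmod_opp.
replace (- (l - csum u n))%C with (csum u n - l)%C by ring; exact hn.
Qed.

(** The uniform estimate of the Weierstrass test. *)
Lemma series_remainder_le (u : nat -> C) (l : C) (M : nat) :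
  ex_series (fun k => Cmod (u k)) ->
  is_series (K := C_AbsRing) (V := C_NormedModule) u l ->
  Cmod (l - csum u M) <=
  Series (fun k => Cmod (u k)) - sum_n (fun k => Cmod (u k)) M.
Proof.
intros hu hl.
pose proof (Series_correct _ hu) as hs.
set (T := sum_n (fun k => Cmod (u k)) M).
assert (hlim : is_lim_seq (fun n => Cmod (l - csum u n) +
   (sum_n (fun k => Cmod (u k)) n - T)) (0 + (Series (fun k => Cmod (u k)) - T))).
{ apply is_lim_seq_plus'; [now apply is_lim_seq_csum|].
  apply is_lim_seq_minus'; [exact hs|apply is_lim_seq_const]. }
rewrite Rplus_0_l in hlim.
refine (is_lim_seq_le_loc (fun _ => Cmod (l - csum u M)) _
  (Finite _) (Finite _) _ (is_lim_seq_const _) hlim).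
exists M; intros n hn.
replace (l - csum u M)%C with ((l - csum u n) + (csum u n - csum u M))%C by ring.
eapply Rle_trans; [apply Cmod_triangle|].
apply Rplus_le_compat_l; now apply Cmod_csum_sub_le.
Qed.

(** The averages over [N + 1] points are exact on trigonometric polynomials of
    low degree, so that the error is at most a tail of the series of the
    absolute values, which is uniform in [t]. *)
Lemma fourier_coeff_trig_series (u : nat -> C) (f : R -> C) (m : Z) (c : C) :
  ex_series (fun k => Cmod (u k)) ->
  (forall t, is_series (K := C_AbsRing) (V := C_NormedModule)
     (fun k => (u k * cis (INR (S k) * t))%C) (f t)) ->
  (forall M, (Z.abs m <= Z.of_nat M)%Z ->
     csum (fun k => u k * (if Z.eq_dec (Z.of_nat (S k) - m) 0 then 1%C else 0%C))%C M
     = c) ->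
  fourier_coeff f m c.
Proof.
intros hu hf hc; unfold fourier_coeff.
set (T := fun M => Series (fun k => Cmod (u k)) - sum_n (fun k => Cmod (u k)) M).
set (d := Z.abs_nat m).
assert (hT : is_lim_seq T 0).
{ replace 0 with (Series (fun k => Cmod (u k)) - Series (fun k => Cmod (u k))) by ring.
  apply is_lim_seq_minus'; [apply is_lim_seq_const|exact (Series_correct _ hu)]. }
(* A partial sum up to index [n + d] contains the frequency [m], and after
   multiplication by the character of frequency [- m] its frequencies are at
   most [n + 2 d + 1] in absolute value. *)
apply (is_lim_seq_incr_n _ (2 * d + 1)).
apply (is_lim_seq_le_le (fun _ => 0) _ (fun n => T (n + d)%nat));
  [|apply is_lim_seq_const|now apply (is_lim_seq_incr_n T d)].
intros n; split; [apply Cmod_ge_0|].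
set (N := (n + (2 * d + 1))%nat).
set (P := fun t => csum (fun k => u k * cis (INR (S k) * t))%C (n + d)).
assert (hP : mean N (fun t => P t * cis (- (IZR m * t)))%C = c).
{ rewrite <- (hc (n + d)%nat) by lia.
  rewrite (mean_ext N _ (fun t => csum (fun k =>
    u k * cis (IZR (Z.of_nat (S k) - m) * t))%C (n + d))).
  - rewrite mean_csum.
    unfold csum at 1 2; apply sum_n_m_ext_loc; intros k hk.
    rewrite mean_scal, mean_cis by lia; reflexivity.
  - intros t; unfold P; rewrite Cmult_comm, <- csum_scal.
    apply csum_ext; intros k.
    rewrite minus_IZR, <- INR_IZR_INZ, Rmult_minus_distr_r.
    unfold Rminus; rewrite cis_plus; ring. }
rewrite <- hP at 1.
replace (_ - _)%C with (mean N (fun t => (f t - P t) * cis (- (IZR m * t)))%C).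
- apply Cmod_mean_le; intros t.
  rewrite Cmod_mult, Cmod_cis, Rmult_1_r.
  assert (he : forall k, Cmod (u k * cis (INR (S k) * t)) = Cmod (u k))
    by (intros k; now rewrite Cmod_mult, Cmod_cis, Rmult_1_r).
  unfold T; rewrite <- (Series_ext _ _ he), <- (sum_n_ext _ _ _ he).
  apply series_remainder_le; [|apply hf].
  eapply ex_series_ext; [|exact hu]; intros k; now rewrite he.
- replace (mean N (fun t => f t * cis (- (IZR m * t)))%C)
    with (mean N (fun t => (f t - P t) * cis (- (IZR m * t))
      + P t * cis (- (IZR m * t)))%C) by (apply mean_ext; intros t; ring).
  rewrite mean_plus; ring.
Qed.

(** With [Q] the orthogonal projection of [f] on the two modes, expand the
    average of [|f - Q| ^ 2 >= 0]. Replacing [|f| ^ 2] by its bound [K ^ 2]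
    beforehand leaves an expression [phi] that is linear in [f]. *)
Lemma discrete_bessel (N : nat) (f : R -> C) (K : R) (m m' : Z) (c d : C) :
  m <> m' -> (Z.abs (m - m') <= Z.of_nat N)%Z ->
  (forall t, Cmod (f t) <= K) ->
  c = mean N (fun t => f t * cis (- (IZR m * t)))%C ->
  d = mean N (fun t => f t * cis (- (IZR m' * t)))%C ->
  Cmod c ^ 2 + Cmod d ^ 2 <= K ^ 2.
Proof.
intros hne hN hf hc hd.
set (E := fun (k : Z) t => cis (- (IZR k * t))).
(* [E k] is the conjugate of the character of frequency [k]. *)
set (Q := fun t => (c * Cconj (E m t) + d * Cconj (E m' t))%C).
set (phi := fun t => (RtoC (K ^ 2) - 2 * (f t * Cconj (Q t)) + Q t * Cconj (Q t))%C).
assert (hpos : forall t, 0 <= Re (phi t)).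
{ intros t.
  assert (hK : Cmod (f t) ^ 2 <= K ^ 2)
    by (apply pow_incr; split; [apply Cmod_ge_0|apply hf]).
  rewrite Cmod2_alt in hK; unfold phi.
  destruct (f t) as [x y]; destruct (Q t) as [x' y']; cbn in *.
  pose proof (pow2_ge_0 (x - x')); pose proof (pow2_ge_0 (y - y')); cbn in *; nra. }
assert (hE : forall k t, (E k t * Cconj (E k t))%C = 1%C).
{ intros k t; unfold E; rewrite Cconj_cis, <- cis_plus, <- cis_0; f_equal; ring. }
assert (hEE : forall k k', k <> k' -> (Z.abs (k - k') <= Z.of_nat N)%Z ->
  mean N (fun t => Cconj (E k t) * E k' t)%C = 0%C).
{ intros k k' hk hkN.
  rewrite (mean_ext N _ (fun t => cis (IZR (k - k') * t))).
  - rewrite mean_cis by exact hkN; destruct (Z.eq_dec _ _); [lia|reflexivity].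
  - intros t; unfold E; rewrite Cconj_cis, <- cis_plus, minus_IZR; f_equal; ring. }
assert (hphi : mean N phi = (RtoC (K ^ 2) - (c * Cconj c + d * Cconj d))%C).
{ rewrite (mean_ext N phi (fun t =>
    (RtoC (K ^ 2) + (c * Cconj c + d * Cconj d)) +
    ((- (2) * Cconj c) * (f t * E m t) + ((- (2) * Cconj d) * (f t * E m' t) +
    ((c * Cconj d) * (Cconj (E m t) * E m' t) +
     (d * Cconj c) * (Cconj (E m' t) * E m t)))))%C).
  - rewrite !mean_plus, !mean_scal, !mean_const, !hEE by lia.
    unfold E; rewrite <- hc, <- hd; ring.
  - intros t; unfold phi, Q.
    rewrite Cplus_conj, !Cmult_conj, !Cconj_conj.
    pose proof (hE m t) as h1; pose proof (hE m' t) as h2.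
    set (e1 := E m t) in *; set (e2 := E m' t) in *.
    transitivity (RtoC (K ^ 2) - 2 * (f t * (Cconj c * e1 + Cconj d * e2)) +
      (c * Cconj c * (e1 * Cconj e1) + d * Cconj d * (e2 * Cconj e2)
       + c * Cconj d * (Cconj e1 * e2) + d * Cconj c * (Cconj e2 * e1)))%C; [ring|].
    rewrite h1, h2; ring. }
pose proof (Re_mean_ge0 N phi hpos) as h.
rewrite hphi, <- !Cmod2_conj in h.
simpl in h; simpl; lra.
Qed.

Lemma bessel (f : R -> C) (K : R) (m m' : Z) (c d : C) :
  m <> m' -> (forall t, Cmod (f t) <= K) ->
  fourier_coeff f m c -> fourier_coeff f m' d -> Cmod c ^ 2 + Cmod d ^ 2 <= K ^ 2.
Proof.
intros hne hf hc hd.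
assert (hlim : forall (x : nat -> C) l, is_lim_seq (fun N => Cmod (x N - l)) 0 ->
  is_lim_seq (fun N => Cmod (x N) ^ 2) (Cmod l ^ 2)).
{ intros x l hx.
  assert (h1 : is_lim_seq (fun N => Cmod (x N)) (Cmod l)).
  { apply (is_lim_seq_le_le (fun N => Cmod l - Cmod (x N - l)) _
      (fun N => Cmod l + Cmod (x N - l))).
    - intros N.
      pose proof (Cmod_triangle (x N - l) l) as h2.
      pose proof (Cmod_triangle (x N) (- (x N - l))) as h3.
      rewrite Cmod_opp in h3.
      replace (x N - l + l)%C with (x N) in h2 by ring.
      replace (x N + - (x N - l))%C with l in h3 by ring; lra.
    - pose proof (is_lim_seq_minus' _ _ _ _ (is_lim_seq_const (Cmod l)) hx) as h.
      now rewrite Rminus_0_r in h.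
    - pose proof (is_lim_seq_plus' _ _ _ _ (is_lim_seq_const (Cmod l)) hx) as h.
      now rewrite Rplus_0_r in h. }
  pose proof (is_lim_seq_mult' _ _ _ _ h1 h1) as h.
  simpl; rewrite Rmult_1_r.
  eapply is_lim_seq_ext; [|exact h]; intros N; cbv beta; simpl; ring. }
refine (is_lim_seq_le_loc _ (fun _ => K ^ 2) (Finite _) (Finite _) _
  (is_lim_seq_plus' _ _ _ _ (hlim _ _ hc) (hlim _ _ hd)) (is_lim_seq_const _)).
exists (Z.abs_nat (m - m')); intros N hN.
apply (discrete_bessel N f K m m'); [exact hne|lia|exact hf|reflexivity..].
Qed.

(** Equations between generic module expressions at type [C] have to be
    restated over [C] itself before [ring] recognizes them. *)
Ltac change_C := match goal with |- ?x = ?y => change (@eq C x y) end.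

(** * Modes of a power series on a circle *)

(** The terms at a larger radius [s < 1] are bounded, hence those at [r] are
    dominated by a geometric series of ratio [r / s]. *)
Lemma power_series_abs (c : nat -> C) (h : C -> C) (r : R) :
  disk_power_series c h -> 0 <= r < 1 ->
  ex_series (fun k => Cmod (c (S k)) * r ^ S k).
Proof.
intros hc hr.
set (s := (1 + r) / 2).
assert (hs : 0 < s < 1) by (unfold s; lra).
assert (hz : unit_disk (RtoC s))
  by (unfold unit_disk; rewrite Cmod_R, Rabs_pos_eq; lra).
specialize (hc (RtoC s) hz).
destruct (filterlim_bounded (K := C_AbsRing) (V := C_NormedModule) _
  (ex_intro _ _ hc)) as [B hB].
set (u := fun k => (c (S k) * RtoC s ^ S k)%C) in *.
assert (hB' : forall n, Cmod (csum u n) <= B) by exact hB.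
assert (hu : forall k, Cmod (c (S k)) * s ^ S k <= 2 * B).
{ intros k.
  replace (Cmod (c (S k)) * s ^ S k) with (Cmod (u k))
    by (unfold u; rewrite Cmod_mult, Cmod_pow, Cmod_R, Rabs_pos_eq; [reflexivity|lra]).
  pose proof (hB' 0%nat) as h0; rewrite csum_O in h0.
  destruct k as [|k].
  - pose proof (Cmod_ge_0 (u 0%nat)); lra.
  - pose proof (hB' k) as h1; pose proof (hB' (S k)) as h2.
    pose proof (Cmod_triangle (csum u (S k)) (- csum u k)) as h3.
    rewrite Cmod_opp in h3; rewrite csum_S in h2, h3.
    replace (csum u k + u (S k) + - csum u k)%C with (u (S k)) in h3 by ring; lra. }
apply (ex_series_le (K := R_AbsRing) (V := R_CompleteNormedModule) _
  (fun k => (2 * B) * (r / s) ^ S k)).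
- intros k; change (norm (Cmod (c (S k)) * r ^ S k))
    with (Rabs (Cmod (c (S k)) * r ^ S k)).
  assert (hq : 0 <= (r / s) ^ S k)
    by (apply pow_le, Rle_mult_inv_pos; lra).
  rewrite Rabs_pos_eq by (apply Rmult_le_pos; [apply Cmod_ge_0|apply pow_le; lra]).
  replace (r ^ S k) with (s ^ S k * (r / s) ^ S k)
    by (rewrite <- Rpow_mult_distr; f_equal; field; lra).
  rewrite <- Rmult_assoc; apply Rmult_le_compat_r; [exact hq|apply hu].
- apply (ex_series_scal_l (K := R_AbsRing) (2 * B) (fun k => (r / s) ^ S k)).
  apply (ex_series_incr_1 (fun k => (r / s) ^ k)), ex_series_geom.
  assert (0 <= r / s) by (apply Rle_mult_inv_pos; lra).
  rewrite Rabs_pos_eq by assumption.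
  apply Rlt_div_l; unfold s; lra.
Qed.

Lemma Cmod_circle (r t : R) : 0 <= r -> Cmod (RtoC r * cis t) = r.
Proof. intros hr; rewrite Cmod_mult, Cmod_cis, Cmod_R, Rabs_pos_eq; lra. Qed.

Lemma fourier_coeff_power_series (c : nat -> C) (h : C -> C) (r al : R) (j : nat) :
  disk_power_series c h -> 0 <= r < 1 -> (1 <= j)%nat ->
  fourier_coeff (fun t => h (RtoC r * cis (t + al))%C) (Z.of_nat j)
    (cis (INR j * al) * (RtoC (r ^ j) * c j))%C /\
  fourier_coeff (fun t => h (RtoC r * cis (t + al))%C) (- Z.of_nat j) 0%C.
Proof.
intros hc hr hj.
set (u := fun k => (cis (INR (S k) * al) * (RtoC (r ^ S k) * c (S k)))%C).
assert (hu : ex_series (fun k => Cmod (u k))).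
{ eapply ex_series_ext; [|exact (power_series_abs c h r hc hr)].
  intros k; unfold u; simpl Nat.add.
  rewrite !Cmod_mult, Cmod_cis, Cmod_R, Rabs_pos_eq by (apply pow_le; lra).
  simpl; ring. }
assert (hf : forall t, is_series (K := C_AbsRing) (V := C_NormedModule)
  (fun k => (u k * cis (INR (S k) * t))%C) (h (RtoC r * cis (t + al))%C)).
{ intros t; eapply is_series_ext; [|apply hc].
  - intros k; unfold u.
    rewrite Cpow_mult_l, <- RtoC_pow, cis_pow, Rmult_plus_distr_l, cis_plus.
    change_C; ring.
  - unfold unit_disk; rewrite Cmod_circle; lra. }
split; apply (fourier_coeff_trig_series u); try assumption; intros M hM.
- rewrite (csum_single _ (j - 1)).
  + destruct (Z.eq_dec _ _) as [_|h0]; [|lia].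
    unfold u; replace (S (j - 1)) with j by lia; ring.
  + intros k hk; destruct (Z.eq_dec _ _); [lia|ring].
  + lia.
- rewrite (csum_single _ 0); [|intros k _|lia];
    (destruct (Z.eq_dec _ _); [lia|ring]).
Qed.

(** The factors [cis (j al)] and its conjugate both change sign between
    [al = 0] and [al = PI / j]. *)
Lemma fourier_coeff_form (p : nat) (F : C -> C) (a b : nat -> nat -> C) (r al : R)
    (j : nat) :
  polyharmonic_form p a b F -> 0 <= r < 1 -> (1 <= j)%nat ->
  fourier_coeff (fun t => F (RtoC r * cis (t + al))%C) (Z.of_nat j)
    (cis (INR j * al) * sum_n_m (G := C_AbelianMonoid)
      (fun n => RtoC (r ^ (2 * (n - 1) + j)) * a n j)%C 1 p)%C /\
  fourier_coeff (fun t => F (RtoC r * cis (t + al))%C) (- Z.of_nat j)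
    (cis (- (INR j * al)) * sum_n_m (G := C_AbelianMonoid)
      (fun n => RtoC (r ^ (2 * (n - 1) + j)) * Cconj (b n j))%C 1 p)%C.
Proof.
intros (h & g & hhg & hF) hr hj.
set (G := fun n t => (RtoC (r ^ (2 * (n - 1))) *
  (h n (RtoC r * cis (t + al)) + Cconj (g n (RtoC r * cis (t + al)))))%C).
assert (hFG : forall t, sum_n_m (G := C_AbelianMonoid) (fun n => G n t) 1 p
   = F (RtoC r * cis (t + al))%C).
{ intros t; rewrite hF by (unfold unit_disk; rewrite Cmod_circle; lra).
  now rewrite Cmod_circle by lra. }
split; eapply fourier_coeff_ext; try exact hFG.
- rewrite <- (sum_n_m_mult_l (K := C_Ring)).
  apply fourier_coeff_sum; intros n hn; destruct (hhg n hn) as [hh hg].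
  destruct (fourier_coeff_power_series _ _ r al j hh hr hj) as [hh1 _].
  destruct (fourier_coeff_power_series _ _ r al j hg hr hj) as [_ hg1].
  apply fourier_coeff_conj in hg1; rewrite Z.opp_involutive in hg1.
  pose proof (fourier_coeff_scal (RtoC (r ^ (2 * (n - 1)))) _ _ _
    (fourier_coeff_plus _ _ _ _ _ hh1 hg1)) as H.
  replace (mult _ _) with (RtoC (r ^ (2 * (n - 1))) *
    (cis (INR j * al) * (RtoC (r ^ j) * a n j) + Cconj 0))%C; [exact H|].
  change (mult ?x ?y) with (Cmult x y); change_C.
  rewrite pow_add, RtoC_mult.
  rewrite Cconj_RtoC; ring.
- rewrite <- (sum_n_m_mult_l (K := C_Ring)).
  apply fourier_coeff_sum; intros n hn; destruct (hhg n hn) as [hh hg].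
  destruct (fourier_coeff_power_series _ _ r al j hh hr hj) as [_ hh1].
  destruct (fourier_coeff_power_series _ _ r al j hg hr hj) as [hg1 _].
  apply fourier_coeff_conj in hg1.
  pose proof (fourier_coeff_scal (RtoC (r ^ (2 * (n - 1)))) _ _ _
    (fourier_coeff_plus _ _ _ _ _ hh1 hg1)) as H.
  replace (mult _ _) with (RtoC (r ^ (2 * (n - 1))) *
    (0 + Cconj (cis (INR j * al) * (RtoC (r ^ j) * b n j))))%C; [exact H|].
  change (mult ?x ?y) with (Cmult x y); change_C.
  rewrite pow_add, RtoC_mult, !Cmult_conj, Cconj_cis, Cconj_RtoC.
  ring.
Qed.

(** The two rotations of [F] by [0] and by [PI / j] are subtracted: this doubles
    the modes [j] and [- j], and the difference is bounded by the diameter. *)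
Lemma mode_pair_le (p : nat) (F : C -> C) (a b : nat -> nat -> C) (K r : R)
    (j : nat) :
  polyharmonic_form p a b F -> 0 <= r < 1 -> (1 <= j)%nat ->
  (forall z w, unit_disk z -> unit_disk w -> Cmod (F z - F w) <= K) ->
  4 * (Cmod (sum_n_m (G := C_AbelianMonoid)
         (fun n => RtoC (r ^ (2 * (n - 1) + j)) * a n j)%C 1 p) ^ 2 +
       Cmod (sum_n_m (G := C_AbelianMonoid)
         (fun n => RtoC (r ^ (2 * (n - 1) + j)) * Cconj (b n j))%C 1 p) ^ 2)
  <= K ^ 2.
Proof.
intros hF hr hj hK.
destruct (fourier_coeff_form p F a b r 0 j hF hr hj) as [ha0 hb0].
destruct (fourier_coeff_form p F a b r (PI / INR j) j hF hr hj) as [ha1 hb1].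
revert ha0 hb0 ha1 hb1.
set (A := sum_n_m _ 1 p); set (B := sum_n_m _ 1 p); intros ha0 hb0 ha1 hb1.
assert (hjR : INR j <> 0) by (apply not_0_INR; lia).
replace (INR j * (PI / INR j)) with PI in ha1, hb1 by (field; exact hjR).
rewrite Rmult_0_r in ha0, hb0; rewrite Ropp_0 in hb0; rewrite cis_0 in ha0, hb0.
assert (hpi : cis PI = (- (1))%C)
  by (unfold cis, Copp; rewrite cos_PI, sin_PI; simpl; f_equal; ring).
assert (hpi' : cis (- PI) = (- (1))%C).
{ rewrite <- Cconj_cis, hpi; unfold Cconj, Copp; simpl; f_equal; ring. }
rewrite hpi in ha1; rewrite hpi' in hb1.
pose proof (fourier_coeff_plus _ _ _ _ _ ha0 (fourier_coeff_scal (- (1))%C _ _ _ ha1)) as ha.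
pose proof (fourier_coeff_plus _ _ _ _ _ hb0 (fourier_coeff_scal (- (1))%C _ _ _ hb1)) as hb.
cbv beta in ha, hb.
replace (1 * A + - (1) * (- (1) * A))%C with (2 * A)%C in ha by ring.
replace (1 * B + - (1) * (- (1) * B))%C with (2 * B)%C in hb by ring.
replace (4 * (Cmod A ^ 2 + Cmod B ^ 2))
  with (Cmod (2 * A)%C ^ 2 + Cmod (2 * B)%C ^ 2)
  by (rewrite !Cmod_mult, !Cmod_R, Rabs_pos_eq by lra; ring).
refine (bessel _ K (Z.of_nat j) (- Z.of_nat j) _ _ _ _ ha hb); [lia|].
intros t.
assert (hd : forall s, unit_disk (RtoC r * cis s)%C)
  by (intros s; unfold unit_disk; rewrite Cmod_circle; lra).
refine (Rle_trans _ _ _ _ (hK _ _ (hd (t + 0)) (hd (t + PI / INR j)))).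
right; f_equal; change_C; ring.
Qed.

(** * Sums of vectors whose mutual angles are at most [PI / 2] *)

(** [x * conj y] is a nonnegative multiple of [x / y]. *)
Lemma Re_mul_conj_ge0_of_Carg (x y : C) : x <> 0%C -> y <> 0%C ->
  Rabs (Carg (x / y)%C) <= PI / 2 -> 0 <= Re (x * Cconj y)%C.
Proof.
intros hx hy harg.
assert (hq : (x / y)%C <> 0%C).
{ intros h; apply hx; replace x with (x / y * y)%C by (field; exact hy).
  rewrite h; ring. }
destruct (Carg_spec _ hq) as [_ he].
assert (hre : 0 <= Re (x / y)%C).
{ rewrite he; simpl; apply Rmult_le_pos; [apply Cmod_ge_0|].
  apply Rabs_le_between in harg; apply cos_ge_0; lra. }
replace (x * Cconj y)%C with (RtoC (Cmod y ^ 2) * (x / y))%C.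
- rewrite re_scal_l; apply Rmult_le_pos; [apply pow2_ge_0|exact hre].
- rewrite Cmod2_conj; field; exact hy.
Qed.

(** Acute angles make all cross terms of the squared norm of the sum
    nonnegative, so that it is at least the sum of the squares; the
    factor [p] is then the Cauchy-Schwarz inequality. *)
Lemma sum_Cmod_sq_le (p : nat) (v : nat -> C) :
  (forall n m, (1 <= n <= p)%nat -> (1 <= m <= p)%nat ->
     0 <= Re (v n * Cconj (v m))%C) ->
  (sum_n_m (fun n => Cmod (v n)) 1 p) ^ 2 <=
  INR p * Cmod (sum_n_m (G := C_AbelianMonoid) v 1 p) ^ 2.
Proof.
intros hv.
assert (hcross : forall q, (q <= p)%nat -> forall m, (1 <= m <= p)%nat ->
  0 <= Re (sum_n_m (G := C_AbelianMonoid) v 1 q * Cconj (v m))%C).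
{ intros q; induction q as [|q IH]; intros hq m hm.
  - rewrite sum_n_m_zero by lia; unfold zero; simpl; lra.
  - rewrite sum_n_Sm by lia.
    change (plus ?x ?y) with (Cplus x y).
    rewrite Cmult_plus_distr_r, re_plus.
    specialize (IH ltac:(lia) m hm); specialize (hv (S q) m ltac:(lia) hm); lra. }
(* [Q] is the sum of the squares of the moduli. *)
assert (h : forall q, (q <= p)%nat ->
  exists Q, (sum_n_m (fun n => Cmod (v n)) 1 q) ^ 2 <= INR q * Q /\
    0 <= Q <= Cmod (sum_n_m (G := C_AbelianMonoid) v 1 q) ^ 2).
{ intros q; induction q as [|q IH]; intros hq.
  - exists 0; rewrite sum_n_m_zero by lia; unfold zero; simpl.
    split; [lra|split; [lra|apply pow2_ge_0]].
  - destruct (IH ltac:(lia)) as (Q & hX & hQ0 & hQ).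
    specialize (hcross q ltac:(lia) (S q) ltac:(lia)).
    rewrite !sum_n_Sm by lia.
    exists (Q + Cmod (v (S q)) ^ 2).
    set (X := sum_n_m (fun n => Cmod (v n)) 1 q) in *.
    set (V := sum_n_m v 1 q) in *.
    change (plus X (Cmod (v (S q)))) with (X + Cmod (v (S q))).
    change (plus V (v (S q))) with (V + v (S q))%C.
    set (x := Cmod (v (S q))) in *.
    split; [|split].
    + rewrite S_INR; pose proof (pos_INR q) as hq0.
      destruct (Req_dec (INR q) 0) as [h0|h0].
      * rewrite h0 in *; assert (X = 0) by nra; subst; nra.
      * assert (0 < INR q) by lra.
        assert (2 * X * x <= Q + INR q * x ^ 2).
        { apply (Rmult_le_reg_l (INR q)); [lra|].
          pose proof (pow2_ge_0 (X - INR q * x)); nra. }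
        nra.
    + pose proof (pow2_ge_0 x); lra.
    + unfold x; rewrite !Cmod2_alt in *; rewrite !re_plus, !im_plus.
      destruct V as [v1 v2]; destruct (v (S q)) as [w1 w2]; simpl in *; nra. }
destruct (h p (le_n p)) as (Q & hX & hQ0 & hQ).
pose proof (pos_INR p); nra.
Qed.

(** * The coefficient estimate *)

(** Carries the estimates on circles of radius [r < 1] to the limit [r = 1]. *)
Lemma le_of_pow_mul_le (m : nat) (X Y : R) :
  (forall r, 0 < r < 1 -> r ^ m * X <= Y) -> X <= Y.
Proof.
intros h.
assert (hr : is_lim_seq (fun n => 1 - (1 / 2) ^ S n) 1).
{ replace (Finite 1) with (Finite (1 - 0)) by (f_equal; ring).
  apply is_lim_seq_minus'; [apply is_lim_seq_const|].
  apply (is_lim_seq_incr_1 (fun n => (1 / 2) ^ n)), is_lim_seq_geom.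
  rewrite Rabs_pos_eq; lra. }
assert (hc : continuity_pt (fun r => r ^ m * X) 1) by reg.
pose proof (is_lim_seq_continuous _ _ _ hc hr) as hl; cbv beta in hl.
rewrite pow1, Rmult_1_l in hl.
refine (is_lim_seq_le _ (fun _ => Y) (Finite _) (Finite _) _ hl (is_lim_seq_const Y)).
intros n; apply h.
assert (0 < (1 / 2) ^ n <= 1).
{ split; [apply pow_lt; lra|].
  refine (Rle_trans _ _ _ (pow_incr _ 1 n _) (Req_le _ _ (pow1 n))); lra. }
simpl; lra.
Qed.

Lemma Diam_cases (F : C -> C) :
  Diam_image_disk F = p_infty \/
  exists K, Diam_image_disk F = Finite K /\ 0 <= K /\
    forall z w, unit_disk z -> unit_disk w -> Cmod (F z - F w)%C <= K.
Proof.
unfold Diam_image_disk.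
set (E := fun r => exists z w, _).
destruct (Lub_Rbar_correct E) as [hub _]; unfold is_ub_Rbar in hub.
assert (hE : forall z w, unit_disk z -> unit_disk w -> E (Cmod (F z - F w)%C))
  by (intros z w hz hw; exists z, w; auto).
assert (h0 : unit_disk 0%C) by (unfold unit_disk; rewrite Cmod_0; lra).
pose proof (hub _ (hE _ _ h0 h0)) as h00.
destruct (Lub_Rbar E) as [K| |]; [right|now left|contradiction].
exists K; split; [reflexivity|split].
- eapply Rle_trans; [apply Cmod_ge_0|exact h00].
- intros z w hz hw; exact (hub _ (hE _ _ hz hw)).
Qed.

Lemma Rbar_mult_pos_infty (s : R) : 0 < s -> Rbar_mult (Finite s) p_infty = p_infty.
Proof.
intros hs; simpl; destruct (Rle_dec 0 s); [|lra].
destruct (Rle_lt_or_eq_dec 0 s r); [reflexivity|lra].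
Qed.

(** The weights depend on [n], but none is smaller than [r ^ (2 p + j)], and
    positive weights do not affect the angles. *)
Lemma sum_scaled_sq_le (p : nat) (c : nat -> C) (r : R) (j : nat) : 0 < r < 1 ->
  (forall n m, (1 <= n <= p)%nat -> (1 <= m <= p)%nat ->
     0 <= Re (c n * Cconj (c m))%C) ->
  (r ^ (2 * p + j) * sum_n_m (fun n => Cmod (c n)) 1 p) ^ 2 <=
  INR p * Cmod (sum_n_m (G := C_AbelianMonoid)
    (fun n => RtoC (r ^ (2 * (n - 1) + j)) * c n)%C 1 p) ^ 2.
Proof.
intros hr hc.
assert (hpow : forall k, 0 < r ^ k) by (intros k; apply pow_lt; lra).
eapply Rle_trans; [|apply sum_Cmod_sq_le].
- apply pow_incr; split.
  + apply Rmult_le_pos; [now left|].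
    clear hc; induction p as [|p IH].
    * rewrite sum_n_m_zero by lia; unfold zero; simpl; lra.
    * rewrite sum_n_Sm by lia; apply Rplus_le_le_0_compat; [exact IH|apply Cmod_ge_0].
  + rewrite <- (sum_n_m_mult_l (K := R_Ring)).
    clear hc.
    assert (h : forall q, (q <= p)%nat ->
      sum_n_m (fun n => r ^ (2 * p + j) * Cmod (c n)) 1 q <=
      sum_n_m (fun n => Cmod (RtoC (r ^ (2 * (n - 1) + j)) * c n)%C) 1 q);
      [|exact (h p (le_n p))].
    intros q; induction q as [|q IH]; intros hq.
    * rewrite !sum_n_m_zero by lia; apply Rle_refl.
    * rewrite !sum_n_Sm by lia; apply Rplus_le_compat; [apply IH; lia|].
      rewrite Cmod_mult, Cmod_R, Rabs_pos_eq by now left.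
      apply Rmult_le_compat_r; [apply Cmod_ge_0|].
      replace (2 * p + j)%nat
        with ((2 * (S q - 1) + j) + (2 * p - 2 * (S q - 1)))%nat by lia.
      rewrite pow_add.
      pose proof (pow_incr r 1 (2 * p - 2 * (S q - 1)) ltac:(lra)) as h1.
      rewrite pow1 in h1; specialize (hpow (2 * (S q - 1) + j)%nat); nra.
- intros n m hn hm.
  set (x := r ^ (2 * (n - 1) + j)); set (y := r ^ (2 * (m - 1) + j)).
  replace (RtoC x * c n * Cconj (RtoC y * c m))%C
    with (RtoC (x * y) * (c n * Cconj (c m)))%C.
  + rewrite re_scal_l; apply Rmult_le_pos; [|now apply hc].
    apply Rmult_le_pos; left; apply hpow.
  + rewrite Cmult_conj, RtoC_mult, Cconj_RtoC; ring.
Qed.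

Lemma arg_condition_Re_ge0 (p : nat) (c : nat -> nat -> C) (j : nat) :
  arg_condition p c -> (1 <= j)%nat ->
  forall n m, (1 <= n <= p)%nat -> (1 <= m <= p)%nat ->
    0 <= Re (c n j * Cconj (c m j))%C.
Proof.
intros hc hj n m hn hm.
destruct (Ceq_dec (c n j) 0) as [h|h]; [rewrite h; simpl; lra|].
destruct (Ceq_dec (c m j) 0) as [h'|h']; [rewrite h'; simpl; lra|].
apply Re_mul_conj_ge0_of_Carg; auto.
Qed.

Lemma coefficient_sq_le (p : nat) (F : C -> C) (a b : nat -> nat -> C) (K : R)
    (j : nat) :
  polyharmonic_form p a b F -> arg_condition p a -> arg_condition p b ->
  (1 <= j)%nat ->
  (forall z w, unit_disk z -> unit_disk w -> Cmod (F z - F w)%C <= K) ->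
  4 * (sum_n_m (fun n => Cmod (a n j)) 1 p ^ 2 +
       sum_n_m (fun n => Cmod (b n j)) 1 p ^ 2) <= INR p * K ^ 2.
Proof.
intros hF ha hb hj hK.
apply (le_of_pow_mul_le (2 * (2 * p + j))); intros r hr.
pose proof (arg_condition_Re_ge0 p a j ha hj) as ha'.
pose proof (arg_condition_Re_ge0 p b j hb hj) as hb'.
assert (hb'' : forall n m, (1 <= n <= p)%nat -> (1 <= m <= p)%nat ->
  0 <= Re (Cconj (b n j) * Cconj (Cconj (b m j)))%C).
{ intros n m hn hm; rewrite <- Cmult_conj, re_conj; now apply hb'. }
pose proof (sum_scaled_sq_le p (fun n => a n j) r j hr ha') as hA.
pose proof (sum_scaled_sq_le p (fun n => Cconj (b n j)) r j hr hb'') as hB.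
rewrite (sum_n_m_ext _ (fun n => Cmod (b n j))) in hB
  by (intros n; apply Cmod_conj).
pose proof (mode_pair_le p F a b K r j hF ltac:(lra) hj hK) as hm.
cbv beta in hA, hB.
rewrite Rpow_mult_distr, <- pow_mult, Nat.mul_comm in hA, hB.
pose proof (pos_INR p) as hp.
apply (Rmult_le_compat_l _ _ _ hp) in hm.
lra.
Qed.

Lemma le_sqrt_mul (X K s : R) : 0 <= s -> 0 <= K -> 4 * X ^ 2 <= s * K ^ 2 ->
  X <= sqrt s / 2 * K.
Proof.
intros hs hK h.
pose proof (sqrt_pos s) as hq; pose proof (sqrt_sqrt s hs) as hss.
apply Rnot_lt_le; intros hlt.
assert (0 <= sqrt s / 2 * K) by (apply Rmult_le_pos; lra).
assert ((sqrt s / 2 * K) ^ 2 < X ^ 2) by (simpl; nra).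
assert (4 * (sqrt s / 2 * K) ^ 2 = s * K ^ 2); [|lra].
transitivity (sqrt s * sqrt s * K ^ 2); [field|now rewrite hss].
Qed.

Lemma coefficient_estimates (p : nat) (F : C -> C) (a b : nat -> nat -> C)
    (j : nat) :
  (1 <= p)%nat -> polyharmonic_form p a b F ->
  arg_condition p a -> arg_condition p b -> (1 <= j)%nat ->
  Rbar_le (Finite (sum_n_m (fun n => Cmod (a n j)) 1 p))
    (Rbar_mult (Finite (sqrt (INR p) / 2)) (Diam_image_disk F)) /\
  Rbar_le (Finite (sum_n_m (fun n => Cmod (b n j)) 1 p))
    (Rbar_mult (Finite (sqrt (INR p) / 2)) (Diam_image_disk F)) /\
  Rbar_le (Finite (sum_n_m (fun n => Cmod (a n j) + Cmod (b n j)) 1 p))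
    (Rbar_mult (Finite (sqrt (2 * INR p) / 2)) (Diam_image_disk F)).
Proof.
intros hp hF ha hb hj.
assert (hpR : 0 < INR p) by (apply lt_0_INR; lia).
destruct (Diam_cases F) as [->|(K & -> & hK0 & hK)].
- pose proof (sqrt_lt_R0 (INR p) hpR).
  pose proof (sqrt_lt_R0 (2 * INR p) ltac:(lra)).
  rewrite !Rbar_mult_pos_infty by lra; repeat split.
- pose proof (coefficient_sq_le p F a b K j hF ha hb hj hK) as h.
  set (X := sum_n_m (fun n => Cmod (a n j)) 1 p) in *.
  set (Y := sum_n_m (fun n => Cmod (b n j)) 1 p) in *.
  replace (sum_n_m (fun n => Cmod (a n j) + Cmod (b n j)) 1 p) with (X + Y)
    by (symmetry; exact (sum_n_m_plus (G := R_AbelianMonoid) _ _ 1 p)).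
  pose proof (pow2_ge_0 X); pose proof (pow2_ge_0 Y).
  pose proof (pow2_ge_0 (X - Y)).
  simpl Rbar_mult; repeat split; apply le_sqrt_mul; lra || nra.
Qed.

(** * Monomials *)

(** The family [c (x + kappa y) ^ k] contains the powers of [z]
    (for [kappa = i]) and of the conjugate of [z] (for [kappa = - i]), and is
    stable under both partial derivatives. *)
Definition plane_power (kappa c : C) (k : nat) (z : C) : C :=
  (c * (RtoC (Re z) + kappa * RtoC (Im z)) ^ k)%C.

(** Differentiation by coordinates, which is how partial derivatives are
    taken. *)
Definition is_derive_C (f : R -> C) (x : R) (l : C) : Prop :=
  is_derive (fun t => Re (f t)) x (Re l) /\ is_derive (fun t => Im (f t)) x (Im l).

Lemma is_derive_C_mult (f g : R -> C) (x : R) (l l' : C) :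
  is_derive_C f x l -> is_derive_C g x l' ->
  is_derive_C (fun t => f t * g t)%C x (l * g x + f x * l')%C.
Proof.
intros [hf1 hf2] [hg1 hg2]; split; simpl.
- replace (_ + _) with ((Re l * Re (g x) + Re (f x) * Re l') -
    (Im l * Im (g x) + Im (f x) * Im l')) by (unfold Re, Im; ring).
  apply (is_derive_minus (V := R_NormedModule)
    (fun t => Re (f t) * Re (g t)) (fun t => Im (f t) * Im (g t)));
    apply (is_derive_mult (K := R_AbsRing)); auto; intros; apply Rmult_comm.
- replace (_ + _) with ((Re l * Im (g x) + Re (f x) * Im l') +
    (Im l * Re (g x) + Im (f x) * Re l')) by (unfold Re, Im; ring).
  apply (is_derive_plus (V := R_NormedModule)
    (fun t => Re (f t) * Im (g t)) (fun t => Im (f t) * Re (g t)));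
    apply (is_derive_mult (K := R_AbsRing)); auto; intros; apply Rmult_comm.
Qed.

Lemma is_derive_C_affine (u v : C) (x : R) :
  is_derive_C (fun t => u + v * RtoC t)%C x v.
Proof.
split; simpl; auto_derive; auto; unfold Re, Im; ring.
Qed.

Lemma is_derive_C_affine_pow (c u v : C) (k : nat) (x : R) :
  is_derive_C (fun t => c * (u + v * RtoC t) ^ k)%C x
    (c * v * RtoC (INR k) * (u + v * RtoC x) ^ (k - 1))%C.
Proof.
assert (hconst : forall d, is_derive_C (fun _ => d) x 0%C)
  by (intros d; split; apply (is_derive_const (K := R_AbsRing) (V := R_NormedModule))).
assert (h : is_derive_C (fun t => (u + v * RtoC t) ^ k)%C x
  (v * RtoC (INR k) * (u + v * RtoC x) ^ (k - 1))%C).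
{ induction k as [|k IH].
  - replace (v * RtoC (INR 0) * (u + v * RtoC x) ^ (0 - 1))%C with (RtoC 0)
      by (simpl INR; ring).
    exact (hconst 1%C).
  - pose proof (is_derive_C_mult _ _ _ _ _ (is_derive_C_affine u v x) IH) as h.
    replace (S k - 1)%nat with k by lia.
    replace (v * RtoC (INR (S k)) * (u + v * RtoC x) ^ k)%C with
      (v * (u + v * RtoC x) ^ k +
       (u + v * RtoC x) * (v * RtoC (INR k) * (u + v * RtoC x) ^ (k - 1)))%C.
    + exact h.
    + rewrite S_INR, RtoC_plus; destruct k as [|k]; [simpl; ring|].
      replace (S k - 1)%nat with k by lia; rewrite Cpow_S; ring. }
pose proof (is_derive_C_mult _ _ _ _ _ (hconst c) h) as h'; cbv beta in h'.
match type of h' with is_derive_C _ _ ?l =>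
  replace (c * v * RtoC (INR k) * (u + v * RtoC x) ^ (k - 1))%C with l by ring end.
exact h'.
Qed.

(** A map into the plane is the combination of its two coordinates with the
    constant vectors [1] and [i]. *)
Lemma is_derive_C_ex_derive (f : R -> C) (x : R) (l : C) :
  is_derive_C f x l -> ex_derive (V := C_R_NormedModule) f x.
Proof.
intros [h1 h2].
exists (plus (scal (Re l) (RtoC 1 : C_R_NormedModule))
  (scal (Im l) (Ci : C_R_NormedModule))).
apply (is_derive_ext (V := C_R_NormedModule) (fun t =>
  plus (scal (Re (f t)) (RtoC 1 : C_R_NormedModule))
    (scal (Im (f t)) (Ci : C_R_NormedModule)))).
- intros t; rewrite (surjective_pairing (f t)) at 3.
  unfold plus, scal; simpl; unfold prod_plus, prod_scal, scal, plus; simpl.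
  unfold mult, Re, Im; simpl; f_equal; ring.
- apply (is_derive_plus (V := C_R_NormedModule));
    now apply (is_derive_scal_l (V := C_R_NormedModule)).
Qed.

Lemma is_derive_C_unique (f : R -> C) (x : R) (l : C) : is_derive_C f x l ->
  (Derive (fun t => Re (f t)) x, Derive (fun t => Im (f t)) x) = l.
Proof.
intros [h1 h2]; rewrite (surjective_pairing l).
f_equal; now apply is_derive_unique.
Qed.

Lemma plane_power_derive_x (kappa c : C) (k : nat) (z : C) :
  is_derive_C (fun t => plane_power kappa c k (t, Im z)) (Re z)
    (plane_power kappa (c * RtoC (INR k)) (k - 1) z).
Proof.
pose proof (is_derive_C_affine_pow c (kappa * RtoC (Im z)) 1 k (Re z)) as h.
unfold plane_power; simpl Re; simpl Im.
replace (c * RtoC (INR k) * (RtoC (Re z) + kappa * RtoC (Im z)) ^ (k - 1))%C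
  with (c * 1 * RtoC (INR k) * (kappa * RtoC (Im z) + 1 * RtoC (Re z)) ^ (k - 1))%C
  by (rewrite Cmult_1_l, Cmult_1_r, (Cplus_comm (kappa * _)); reflexivity).
replace (fun t => c * (RtoC t + kappa * RtoC (Im z)) ^ k)%C
  with (fun t => c * (kappa * RtoC (Im z) + 1 * RtoC t) ^ k)%C; [exact h|].
apply functional_extensionality; intros t.
now rewrite Cmult_1_l, Cplus_comm.
Qed.

Lemma plane_power_derive_y (kappa c : C) (k : nat) (z : C) :
  is_derive_C (fun t => plane_power kappa c k (Re z, t)) (Im z)
    (plane_power kappa (c * kappa * RtoC (INR k)) (k - 1) z).
Proof. exact (is_derive_C_affine_pow c (RtoC (Re z)) kappa k (Im z)). Qed.

Lemma partial_x_plane_power (kappa c : C) (k : nat) :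
  partial_x (plane_power kappa c k) =
  plane_power kappa (c * RtoC (INR k)) (k - 1).
Proof.
apply functional_extensionality; intros z.
exact (is_derive_C_unique _ _ _ (plane_power_derive_x kappa c k z)).
Qed.

Lemma partial_y_plane_power (kappa c : C) (k : nat) :
  partial_y (plane_power kappa c k) =
  plane_power kappa (c * kappa * RtoC (INR k)) (k - 1).
Proof.
apply functional_extensionality; intros z.
exact (is_derive_C_unique _ _ _ (plane_power_derive_y kappa c k z)).
Qed.

Lemma continuous_plane_power (kappa c : C) (k : nat) (z : C) :
  continuous (U := C_UniformSpace) (plane_power kappa c k) z.
Proof.
set (cont := fun f : C -> C =>
  continuous (T := C_UniformSpace) (U := R_UniformSpace) (fun z => Re (f z)) z /\
  continuous (T := C_UniformSpace) (U := R_UniformSpace) (fun z => Im (f z)) z).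
assert (hconst : forall d, cont (fun _ => d))
  by (intros d; split; apply continuous_const).
assert (hplus : forall f g, cont f -> cont g -> cont (fun z => f z + g z)%C).
{ intros f g [hf1 hf2] [hg1 hg2]; split; simpl;
    now apply (continuous_plus (V := R_NormedModule)). }
assert (hmult : forall f g, cont f -> cont g -> cont (fun z => f z * g z)%C).
{ intros f g [hf1 hf2] [hg1 hg2]; split; simpl;
    [apply (continuous_minus (V := R_NormedModule))
    |apply (continuous_plus (V := R_NormedModule))];
    now apply (continuous_mult (K := R_AbsRing)). }
assert (hcoord : cont (fun z => RtoC (Re z)) /\ cont (fun z => RtoC (Im z))).
{ pose proof (continuous_const (U := C_UniformSpace) (V := R_UniformSpace) 0 z) as h0.
  destruct z as [x y]; split; (split; [|exact h0]).
  - exact (continuous_fst (U := R_UniformSpace) (V := R_UniformSpace) x y).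
  - exact (continuous_snd (U := R_UniformSpace) (V := R_UniformSpace) x y). }
destruct hcoord as [hre him].
assert (h : cont (plane_power kappa c k)).
{ unfold plane_power; apply hmult; [apply hconst|].
  induction k as [|k IH]; [apply hconst|].
  apply (hmult _ _ (hplus _ _ hre (hmult _ _ (hconst kappa) him)) IH). }
destruct h as [h1 h2].
apply (filterlim_ext (fun z =>
  (Re (plane_power kappa c k z), Im (plane_power kappa c k z)))).
- intros w; now rewrite (surjective_pairing (plane_power kappa c k w)).
- apply (continuous_comp_2 (U := C_UniformSpace) (V := R_UniformSpace)
    (W := R_UniformSpace) (X := C_UniformSpace) _ _ (fun x y => (x, y)) z h1 h2).
  apply (continuous_ext (fun x => x)); [intros x; apply surjective_pairing|].
  apply continuous_id.
Qed.

Lemma smooth_plane_power (o : nat) (kappa c : C) (k : nat) :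
  smooth_disk o (plane_power kappa c k).
Proof.
revert c k; induction o as [|o IH]; intros c k.
- intros z _; apply continuous_plane_power.
- split; [|rewrite partial_x_plane_power, partial_y_plane_power; split; apply IH].
  intros z _; split.
  + exact (is_derive_C_ex_derive _ _ _ (plane_power_derive_x kappa c k z)).
  + exact (is_derive_C_ex_derive _ _ _ (plane_power_derive_y kappa c k z)).
Qed.

(** The Laplacian of a member of the family carries the factor
    [1 + kappa ^ 2]. *)
Lemma Laplacian_plane_power (kappa c : C) (k : nat) (z : C) :
  (kappa * kappa)%C = (- (1))%C -> Laplacian (plane_power kappa c k) z = 0%C.
Proof.
intros hk; unfold Laplacian.
replace (wirtinger_zbar (plane_power kappa c k))
  with (plane_power kappa ((1 + Ci * kappa) / 2 * c * RtoC (INR k)) (k - 1)).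
- unfold wirtinger_z; rewrite partial_x_plane_power, partial_y_plane_power.
  unfold plane_power.
  set (w := (_ ^ (k - 1 - 1))%C).
  transitivity ((1 - (Ci * Ci) * (kappa * kappa)) *
    (c * RtoC (INR k) * RtoC (INR (k - 1)) * w))%C; [field|].
  replace (Ci * Ci)%C with (- (1))%C
    by (unfold Ci, Cmult, Copp, RtoC; simpl; f_equal; ring).
  rewrite hk; ring.
- apply functional_extensionality; intros w; unfold wirtinger_zbar.
  rewrite partial_x_plane_power, partial_y_plane_power.
  unfold plane_power; field.
Qed.

Lemma polyharmonic_plane_power (kappa c : C) (k : nat) :
  (kappa * kappa)%C = (- (1))%C -> polyharmonic_disk 1 (plane_power kappa c k).
Proof.
intros hk; split; [apply smooth_plane_power|].
intros z _; now apply Laplacian_plane_power.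
Qed.

Lemma Cpow_plane_power (c : C) (m : nat) :
  (fun z => c * z ^ m)%C = plane_power Ci c m.
Proof.
apply functional_extensionality; intros [x y]; unfold plane_power.
do 2 f_equal; unfold Ci, Cplus, Cmult, RtoC; simpl; f_equal; ring.
Qed.

Lemma Cconj_pow_plane_power (c : C) (m : nat) :
  (fun z => c * Cconj z ^ m)%C = plane_power (- Ci) c m.
Proof.
apply functional_extensionality; intros [x y]; unfold plane_power.
do 2 f_equal; unfold Ci, Cconj, Cplus, Cmult, Copp, RtoC; simpl; f_equal; ring.
Qed.

Lemma is_series_single (u : nat -> C) (j : nat) :
  (forall k, k <> j -> u k = 0%C) ->
  is_series (K := C_AbsRing) (V := C_NormedModule) u (u j).
Proof.
intros hu; unfold is_series.
apply (filterlim_ext_loc (fun _ => u j)); [|apply filterlim_const].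
exists j; intros n hn; symmetry; now apply (csum_single u j n).
Qed.

Lemma disk_power_series_monomial (c : C) (m : nat) : (1 <= m)%nat ->
  disk_power_series (monomial_coeff c m 1) (fun z => c * z ^ m)%C.
Proof.
intros hm z _.
replace (c * z ^ m)%C with (monomial_coeff c m 1 (S (m - 1)) * z ^ S (m - 1))%C.
- apply (is_series_single (fun k => monomial_coeff c m 1 (S k) * z ^ S k)%C).
  intros k hk; unfold monomial_coeff.
  destruct (Nat.eqb_spec (S k) m); [lia|].
  rewrite Bool.andb_false_r; ring.
- replace (S (m - 1)) with m by lia.
  unfold monomial_coeff; now rewrite !Nat.eqb_refl.
Qed.

Lemma disk_power_series_zero (n : nat) :
  disk_power_series (zero_coeff n) (fun _ => 0%C).
Proof.
intros z _.
replace (RtoC 0) with (zero_coeff n 1 * z ^ 1)%C by (unfold zero_coeff; ring).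
apply (is_series_single (fun k => zero_coeff n (S k) * z ^ S k)%C 0).
intros k _; unfold zero_coeff; ring.
Qed.

Lemma arg_condition_1 (c : nat -> nat -> C) : arg_condition 1 c.
Proof.
intros j n1 n2 hj h1 h2 hc _.
replace n2 with n1 by lia.
replace (c n1 j / c n1 j)%C with (RtoC 1) by (field; exact hc).
unfold Carg; simpl Re; simpl Im; rewrite Cmod_1.
destruct (Rle_dec 0 0); [|lra].
replace (1 / 1) with 1 by field.
rewrite acos_1, Rabs_R0; pose proof PI_RGT_0; lra.
Qed.

Lemma form_monomial (c : C) (m : nat) : (1 <= m)%nat ->
  polyharmonic_form 1 (monomial_coeff c m) zero_coeff (fun z => c * z ^ m)%C.
Proof.
intros hm; exists (fun _ z => c * z ^ m)%C, (fun _ _ => 0%C); split.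
- intros n hn; replace n with 1%nat by lia; split.
  + now apply disk_power_series_monomial.
  + apply disk_power_series_zero.
- intros z _; rewrite sum_n_n, Cconj_RtoC; simpl Nat.mul; rewrite pow_O.
  change_C; ring.
Qed.

Lemma form_conj_monomial (c : C) (m : nat) : (1 <= m)%nat ->
  polyharmonic_form 1 zero_coeff (monomial_coeff (Cconj c) m)
    (fun z => c * Cconj z ^ m)%C.
Proof.
intros hm; exists (fun _ _ => 0%C), (fun _ z => Cconj c * z ^ m)%C; split.
- intros n hn; replace n with 1%nat by lia; split.
  + apply disk_power_series_zero.
  + now apply disk_power_series_monomial.
- intros z _; rewrite sum_n_n, Cmult_conj, Cconj_conj, Cpow_conj.
  simpl Nat.mul; rewrite pow_O; change_C; ring.
Qed.

(** The diameter is at most twice the bound on [F], so that the estimate for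
    [p = 1] leaves no room. *)
Lemma half_Diam_eq (F : C -> C) (M : R) :
  (forall z, unit_disk z -> Cmod (F z) <= M) ->
  Rbar_le (Finite M) (Rbar_mult (Finite (sqrt (INR 1) / 2)) (Diam_image_disk F)) ->
  Finite M = Rbar_mult (Finite (sqrt (INR 1) / 2)) (Diam_image_disk F).
Proof.
intros hF hM.
assert (hle : Rbar_le (Diam_image_disk F) (Finite (2 * M))).
{ apply Lub_Rbar_correct; intros r (z & w & hz & hw & ->); simpl.
  unfold Cminus; eapply Rle_trans; [apply Cmod_triangle|]; rewrite Cmod_opp.
  pose proof (hF z hz); pose proof (hF w hw); lra. }
destruct (Diam_cases F) as [h|(K & h & _)]; rewrite h in *; [contradiction|].
simpl INR in *; rewrite sqrt_1 in *; simpl in *; f_equal; lra.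
Qed.

Lemma Cmod_monomial_le (c z : C) (m : nat) :
  unit_disk z -> Cmod (c * z ^ m) <= Cmod c.
Proof.
intros hz; rewrite Cmod_mult, Cmod_pow.
rewrite <- (Rmult_1_r (Cmod c)) at 2.
apply Rmult_le_compat_l; [apply Cmod_ge_0|].
rewrite <- (pow1 m); apply pow_incr; split; [apply Cmod_ge_0|now left].
Qed.

Lemma sum_monomial_coeff (c : C) (m : nat) :
  sum_n_m (fun n => Cmod (monomial_coeff c m n m)) 1 1 = Cmod c.
Proof. rewrite sum_n_n; unfold monomial_coeff; now rewrite !Nat.eqb_refl. Qed.

Theorem theorem1 :
  (forall (p : nat) (F : C -> C) (a b : nat -> nat -> C),
    (1 <= p)%nat ->
    polyharmonic_disk p F ->
    polyharmonic_form p a b F ->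
    arg_condition p a ->
    arg_condition p b ->
    forall j : nat, (1 <= j)%nat ->
      Rbar_le (Finite (sum_n_m (fun n => Cmod (a n j)) 1 p))
        (Rbar_mult (Finite (sqrt (INR p) / 2)) (Diam_image_disk F)) /\
      Rbar_le (Finite (sum_n_m (fun n => Cmod (b n j)) 1 p))
        (Rbar_mult (Finite (sqrt (INR p) / 2)) (Diam_image_disk F)) /\
      Rbar_le (Finite (sum_n_m (fun n => Cmod (a n j) + Cmod (b n j)) 1 p))
        (Rbar_mult (Finite (sqrt (2 * INR p) / 2)) (Diam_image_disk F))) /\
  (forall (C0 : C) (m : nat), (1 <= m)%nat ->
    let F := fun z : C => (C0 * z ^ m)%C in
    let a := monomial_coeff C0 m in
    let b := zero_coeff in
    polyharmonic_disk 1 F /\ polyharmonic_form 1 a b F /\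
    arg_condition 1 a /\ arg_condition 1 b /\
    Finite (sum_n_m (fun n => Cmod (a n m)) 1 1) =
      Rbar_mult (Finite (sqrt (INR 1) / 2)) (Diam_image_disk F)) /\
  (forall (C0 : C) (m : nat), (1 <= m)%nat ->
    let F := fun z : C => (C0 * Cconj z ^ m)%C in
    let a := zero_coeff in
    let b := monomial_coeff (Cconj C0) m in
    polyharmonic_disk 1 F /\ polyharmonic_form 1 a b F /\
    arg_condition 1 a /\ arg_condition 1 b /\
    Finite (sum_n_m (fun n => Cmod (b n m)) 1 1) =
      Rbar_mult (Finite (sqrt (INR 1) / 2)) (Diam_image_disk F)).
Proof.
split; [|split].
- intros p F a b hp _ hF ha hb j hj; now apply coefficient_estimates.
- intros C0 m hm F a b.
  pose proof (form_monomial C0 m hm) as hform.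
  split; [|split; [exact hform|split; [|split]]]; try apply arg_condition_1.
  + unfold F; rewrite Cpow_plane_power; apply polyharmonic_plane_power.
    unfold Ci, Cmult, Copp, RtoC; simpl; f_equal; ring.
  + unfold a; rewrite sum_monomial_coeff.
    apply half_Diam_eq; [intros z; apply Cmod_monomial_le|].
    rewrite <- (sum_monomial_coeff C0 m).
    apply (coefficient_estimates 1 F a b m); auto using arg_condition_1.
- intros C0 m hm F a b.
  pose proof (form_conj_monomial C0 m hm) as hform.
  split; [|split; [exact hform|split; [|split]]]; try apply arg_condition_1.
  + unfold F; rewrite Cconj_pow_plane_power; apply polyharmonic_plane_power.
    unfold Ci, Cmult, Copp, RtoC; simpl; f_equal; ring.
  + unfold b; rewrite sum_monomial_coeff.
    apply half_Diam_eq.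
    * intros z hz; rewrite Cmod_conj; apply Cmod_monomial_le.
      unfold unit_disk; now rewrite Cmod_conj.
    * rewrite <- (sum_monomial_coeff (Cconj C0) m).
      apply (coefficient_estimates 1 F a b m); auto using arg_condition_1.
Qed.
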